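(* Let $n\ge2$ and consider the cycle graph on nodes $0,1,\dots,n$, where node $i$ is adjacent to nodes $(i-1)\bmod (n+1)$ and $(i+1)\bmod (n+1)$, with starting node $X_0=0$. Then $$\mathbb E_{\pi_{neg}}[T_C]<\tfrac12 (n+1)n=\mathbb E_{\pi_{rw}}[T_C].$$
   Context: $T_C$ is the smallest $m$ such that $X_0,\dots,X_m$ visit all nodes of the graph. Random walk $\pi_{rw}$: if $X_m=i$, $X_{m+1}$ is a uniformly random neighbour of $i$, independently of the past. Negative feedback $\pi_{neg}$: for an edge from $i$ to $j$, let $N_{ij}^{(m)}$ be the number of times $t<m$ with $X_t=i,X_{t+1}=j$. Let $Smin_i^{(m)}$ be the set of neighbours $j$ of $i$ minimizing $N_{ij}^{(m)}$. If $X_m=i$, then given the past, $X_{m+1}$ is uniformly distributed on $Smin_i^{(m)}$. *)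

(* Defs.v *)
From HB Require Import structures.
From mathcomp Require Export all_boot all_order all_algebra.
From mathcomp Require Export all_classical all_reals all_analysis.

Set Implicit Arguments.
Unset Strict Implicit.
Unset Printing Implicit Defensive.

Import Order.TTheory GRing.Theory Num.Theory.
Import numFieldNormedType.Exports.

Local Open Scope classical_set_scope.
Local Open Scope ring_scope.

Definition neighbours (V : finType) (e : rel V) (i : V) : {set V} :=
  [set j | e i j]%SET.

(* [ord_pred i] and [ordS i] are (i - 1) mod n.+1 and (i + 1) mod n.+1. *)
Definition cycle_adj (n : nat) : rel 'I_n.+1 :=
  fun i j => (j == ord_pred i) || (j == ordS i).

Definition traversals (V : finType) (x : nat -> V) (m : nat) (i j : V) : nat :=
  #|[set t : 'I_m | (x t == i) && (x t.+1 == j)]%SET|.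

Definition Smin (V : finType) (e : rel V) (x : nat -> V) (m : nat) (i : V) :
    {set V} :=
  [set j in neighbours e i |
    [forall k in neighbours e i, traversals x m i j <= traversals x m i k]%N]%SET.

(* A policy that moves uniformly on a set determined by the past: [pi m x] is
   the set of candidates for the node at time m.+1; it should only depend on
   x 0, ..., x m. *)
Definition policy (V : finType) : Type := nat -> (nat -> V) -> {set V}.

Definition pi_rw (V : finType) (e : rel V) : policy V :=
  fun m x => neighbours e (x m).

Definition pi_neg (V : finType) (e : rel V) : policy V :=
  fun m x => Smin e x m (x m).

Definition uniform_on (R : realType) (V : finType) (S : {set V}) (j : V) : R :=
  if j \in S then #|S|%:R^-1 else 0.

Definition cond_prob d (T : measurableType d) (R : realType)
    (P : probability T R) (A B : set T) : R :=
  fine (P (A `&` B)) / fine (P B).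

(* Only the values x 0, ..., x m matter. *)
Definition past d (T : measurableType d) (V : finType) (X : nat -> T -> V)
    (m : nat) (x : nat -> V) : set T :=
  [set w | forall t : nat, (t <= m)%N -> X t w = x t].

(* [X] is a process with discrete-valued measurable coordinates, started at
   [x0], whose conditional law of the next node given the past is the one
   prescribed by [pi]. *)
Record follows d (T : measurableType d) (R : realType) (P : probability T R)
    (V : finType) (x0 : V) (pi : policy V) (X : nat -> T -> V) : Prop := {
  follows_measurable : forall (m : nat) (i : V), measurable [set w | X m w = i];
  follows_start : P [set w | X 0%N w = x0] = 1%E;
  follows_step : forall (m : nat) (x : nat -> V) (j : V),
    P (past X m x) <> 0%E ->
    cond_prob P [set w | X m.+1 w = j] (past X m x) = uniform_on R (pi m x) j }.

(* +oo when the path never visits all nodes (infimum of the empty set). *)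
Definition cover_time (R : realType) (V : finType) (x : nat -> V) : \bar R :=
  ereal_inf [set m%:R%:E | m in
    [set m : nat | forall i : V, exists2 t : nat, (t <= m)%N & x t = i]].

Definition expected_cover_time d (T : measurableType d) (R : realType)
    (P : probability T R) (V : finType) (X : nat -> T -> V) : \bar R :=
  (\int[P]_w cover_time R (fun m => X m w))%E.

(* Main.v *)
Require Import Defs.
From mathcomp Require Import zify ring lra measurable_realfun.

Set Implicit Arguments.
Unset Strict Implicit.
Unset Printing Implicit Defensive.

Import Order.TTheory GRing.Theory Num.Theory.
Import numFieldNormedType.Exports.

Local Open Scope classical_set_scope.
Local Open Scope ring_scope.

(* Random walk: the visited set is an arc. If the walker is at distances u and w
   from the two boundary points and the arc has l = u + w - 1 nodes, the
   potential u * w + (l + 1) + ... + n drops by 1 in mean at each step until the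
   graph is covered, so the expected cover time is its initial value
   1 + 2 + ... + n.

   Negative feedback: in fact T_C <= n (n + 1) / 2 on every path. Each node is
   left alternately in pairs of opposite moves, so its bias d_i (number of
   anticlockwise minus clockwise departures) lies in {-1, 0, 1}. Suppose that v
   is not visited up to time m, and cut the cycle at v so that the walk lives
   on an integer interval [a, b] around 0 with b - a = n - 1. With i and X read
   as positions on this interval, X + sum_i d_i = 0 and X^2 + 2 sum_i i d_i = m
   along the path, and d_i <= 0 (resp. >= 0) for i to the left (resp. right) of
   X, as the last departure from i was towards X. Subtracting 2 (a + b) times
   the first identity and bounding the sum term by term gives m < n (n + 1) / 2.
   The inequality of the expectations is strict since the walk 0, 1, ..., n
   has positive probability. *)

(** Lets a policy be evaluated on any extension of a history without changing its candidates. *)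
Definition adapted (V : finType) (pi : policy V) : Prop :=
  forall m x y, (forall t, (t <= m)%N -> x t = y t) -> pi m x = pi m y.

(** * The cover time as a sum of indicators *)

Section CoverTime.
Variables (R : realType) (V : finType).
Implicit Type x : nat -> V.

Definition uncovered x (m : nat) : bool :=
  ~~ [forall i : V, [exists t : 'I_m.+1, x t == i]].

Lemma coveredP x m :
  reflect (forall i : V, exists2 t : nat, (t <= m)%N & x t = i)
          (~~ uncovered x m).
Proof.
rewrite negbK; apply: (iffP forallP) => h i.
  by have /existsP[t /eqP <-] := h i; exists t; rewrite // -ltnS.
by have [t ht <-] := h i; apply/existsP; exists (Ordinal (ht : (t < m.+1)%N)).
Qed.

Lemma uncovered_anti x m m' : (m <= m')%N -> uncovered x m' -> uncovered x m.
Proof.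
move=> mm'; apply: contraLR => /coveredP h; apply/coveredP => i.
by have [t tm <-] := h i; exists t; rewrite ?(leq_trans tm).
Qed.

Lemma eq_uncovered x y m :
  (forall t, (t <= m)%N -> x t = y t) -> uncovered x m = uncovered y m.
Proof.
suff imp z z' : (forall t, (t <= m)%N -> z t = z' t) ->
    uncovered z m -> uncovered z' m.
  by move=> xy; apply/idP/idP; apply: imp => // t tm; rewrite xy.
move=> zz'; apply: contraLR => /coveredP h; apply/coveredP => i.
by have [t tm xti] := h i; exists t; rewrite // zz'.
Qed.

(** Being uncovered passes to earlier times, so the times at which the path is uncovered are exactly
    those before the cover time, and the series counts them. If the path never covers, both sides
    are infinite. *)
Lemma cover_time_series x :
  cover_time R x = (\sum_(m <oo) (uncovered x m)%:R%:E)%E.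
Proof.
have [[m0 cm0]|nc] := pselect (exists m, ~~ uncovered x m); last first.
  have E : [set m : nat | forall i : V, exists2 t : nat, (t <= m)%N & x t = i]
      = set0.
    by apply/seteqP; split => // m /coveredP cm; case: nc; exists m.
  rewrite /cover_time E image_set0 ereal_inf0.
  rewrite (eq_eseriesr (g := fun=> 1%E)); last first.
    move=> m _; have [//|c] := boolP (uncovered x m).
    by case: nc; exists m.
  apply/esym/eqyP => e e0 /=.
  have [k ek] : exists k : nat, (e <= k%:R)%R.
    by exists (Num.bound e); exact/ltW/archi_boundP/ltW.
  apply: le_trans (nneseries_lim_ge k _) => //.
  by rewrite sumEFin lee_fin big_const_nat subn0 iter_addr_0.
have [m cm mmin] := ex_minnP (ex_intro (fun m => ~~ uncovered x m) m0 cm0).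
rewrite (nneseries_split 0 m) //.
rewrite add0n eseries0 ?adde0; last first.
  by move=> k mk _; rewrite (negbTE (contra (uncovered_anti mk) cm)).
rewrite (eq_big_nat _ _ (F2 := fun=> 1%E)); last first.
  move=> k /andP[_ km]; have [//|c] := boolP (uncovered x k).
  by have := mmin _ c; rewrite leqNgt km.
rewrite sumEFin big_const_nat subn0 iter_addr_0.
apply/eqP; rewrite eq_le; apply/andP; split.
  by apply: ge_ereal_inf; exists m%:R%:E => //; exists m => //; apply/coveredP.
apply: le_ereal_inf_tmp => _ [k /coveredP ck <-].
by rewrite lee_fin ler_nat mmin.
Qed.

End CoverTime.

(** * Finite histories of a process and their probabilities *)

Section Process.
Context d (T : measurableType d) (R : realType) (P : probability T R).
Variables (V : finType) (x0 : V) (pi : policy V) (X : nat -> T -> V).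
Hypothesis followsX : follows P x0 pi X.

Let mX m i : measurable [set w | X m w = i] := follows_measurable followsX m i.

Lemma measurable_past m x : measurable (past X m x).
Proof.
rewrite (_ : past X m x =
    \bigcap_(t in [set t | (t <= m)%N]) [set w | X t w = x t]).
  by apply: bigcap_measurable; [exists 0%N|].
by apply/seteqP; split.
Qed.

Lemma measurable_uncovered m : measurable [set w | uncovered (X^~ w) m].
Proof.
rewrite (_ : [set w | _] =
    \bigcup_(i in [set: V]) \bigcap_(t in [set t | (t <= m)%N])
       ~` [set w | X t w = i]).
  apply: fin_bigcup_measurable => // i _.
  by apply: bigcap_measurable => [|t _]; [exists 0%N|exact: measurableC].
apply/seteqP; split => w /=.
  rewrite /uncovered negb_forall => /existsP[i /existsPn hi].
  exists i => // t /= tm.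
  by move/eqP; apply/negP; exact: hi (Ordinal (tm : (t < m.+1)%N)).
move=> [i _ hi]; rewrite /uncovered negb_forall; apply/existsP; exists i.
by apply/existsPn => t; apply/eqP; apply: hi => /=; rewrite -ltnS.
Qed.

(** Monotone convergence exchanges the integral with the series of indicators. *)
Lemma expected_cover_time_tail :
  expected_cover_time P X = (\sum_(m <oo) P [set w | uncovered (X^~ w) m])%E.
Proof.
rewrite /expected_cover_time.
under eq_integral do rewrite cover_time_series.
have indicE m : (fun w => (uncovered (X^~ w) m)%:R%:E : \bar R) =
    (fun w => (\1_[set w | uncovered (X^~ w) m] w)%:E).
  apply/funext => w; rewrite indicE; congr ((nat_of_bool _)%:R%:E).
  by apply/idP/idP => [h|/set_mem//]; apply/mem_set.
rewrite integral_nneseries //.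
- apply: eq_eseriesr => m _.
  rewrite indicE integral_indic ?setIT //; exact: measurable_uncovered.
- move=> m; rewrite indicE; apply/measurable_EFinP.
  exact/measurable_indic/measurable_uncovered.
Qed.

(** All node sequences up to time [m] that the policy allows. They are finitely many, which turns
    probabilities of events up to time [m] into finite sums. A history [h] is read as a path through
    [nth x0 h], whose values beyond time [m] are a mere default. *)
Fixpoint histories m : seq (seq V) :=
  if m is m'.+1 then
    [seq rcons h j | h <- histories m', j <- enum (pi m' (nth x0 h))]
  else [:: [:: x0]].

Lemma size_history m h : h \in histories m -> size h = m.+1.
Proof.
elim: m h => [|m IH] h /=; first by rewrite inE => /eqP->.
by move=> /allpairsPdep[g [j [/IH gm _ ->]]]; rewrite size_rcons gm.
Qed.

Lemma nth_rcons_le h (j : V) m t : size h = m.+1 -> (t <= m)%N ->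
  nth x0 (rcons h j) t = nth x0 h t.
Proof. by move=> sh tm; rewrite nth_rcons sh ltnS tm. Qed.

Lemma nth_rcons_last h (j : V) m : size h = m.+1 ->
  nth x0 (rcons h j) m.+1 = j.
Proof. by move=> sh; rewrite nth_rcons sh ltnn eqxx. Qed.

Lemma past_rcons m h j : size h = m.+1 ->
  past X m.+1 (nth x0 (rcons h j)) =
  past X m (nth x0 h) `&` [set w | X m.+1 w = j].
Proof.
move=> sh; apply/seteqP; split => w /=.
  move=> hw; split; last by rewrite hw // (nth_rcons_last _ sh).
  by move=> t tm; rewrite hw ?(leq_trans tm) // (nth_rcons_le _ sh).
move=> [hw hj] t; rewrite leq_eqVlt => /predU1P[->|tm].
  by rewrite (nth_rcons_last _ sh).
by rewrite (nth_rcons_le _ sh) // hw.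
Qed.

(** Each node was chosen from the candidates of a shorter prefix; adaptedness transfers this to the
    path of the whole history. *)
Lemma history_step m h : adapted pi -> h \in histories m ->
  forall t, (t < m)%N -> nth x0 h t.+1 \in pi t (nth x0 h).
Proof.
move=> adapted_pi; elim: m h => [|m IH] h //=.
move=> /allpairsPdep[g [j [gm jp ->]]] t; rewrite ltnS leq_eqVlt.
have sg := size_history gm.
have past_g s k : (k <= s)%N -> (s <= m)%N ->
    nth x0 (rcons g j) k = nth x0 g k.
  by move=> ks sm; apply: nth_rcons_le sg _; exact: leq_trans sm.
move=> /predU1P[->|tm].
  rewrite (nth_rcons_last _ sg) (adapted_pi _ _ (nth x0 g)) 1?mem_enum //.
    by rewrite mem_enum in jp.
  by move=> k km; exact: past_g km (leqnn m).
rewrite (past_g t.+1) // (adapted_pi _ _ (nth x0 g)); first exact: IH.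
by move=> k kt; exact: past_g kt (ltnW tm).
Qed.

Definition weight m h : R := fine (P (past X m (nth x0 h))).

Lemma weight_ge0 m h : 0 <= weight m h.
Proof. by rewrite fine_ge0. Qed.

Lemma weightE m h : P (past X m (nth x0 h)) = (weight m h)%:E.
Proof. by rewrite fineK // fin_num_measure //; exact: measurable_past. Qed.

Lemma weight0 : weight 0 [:: x0] = 1.
Proof.
rewrite /weight (_ : past _ _ _ = [set w | X 0%N w = x0]).
  by rewrite (follows_start followsX).
apply/seteqP; split => w /=; first by move=> /(_ 0%N isT).
by move=> hw t; rewrite leqn0 => /eqP ->.
Qed.

Lemma weight_rcons m h j : size h = m.+1 ->
  weight m.+1 (rcons h j) = weight m h * uniform_on R (pi m (nth x0 h)) j.
Proof.
(* The conditional law says nothing about a null past, but then the longer past is null by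
   monotonicity. *)
move=> sh; have [w0|w0] := eqVneq (weight m h) 0.
  rewrite w0 mul0r /weight past_rcons //; apply/eqP.
  rewrite eq_le fine_ge0 // andbT -[leRHS]w0; apply: fine_le.
  - by apply/fin_num_measure/measurableI => //; exact: measurable_past.
  - by apply/fin_num_measure; exact: measurable_past.
  - apply: le_measure; rewrite ?inE //; last exact: measurable_past.
    by apply: measurableI => //; exact: measurable_past.
have Pn0 : P (past X m (nth x0 h)) <> 0%E.
  by move=> P0; move/eqP: w0; apply; rewrite /weight P0.
have := follows_step followsX j Pn0; rewrite /cond_prob => <-.
by rewrite mulrC divfK // setIC -past_rcons.
Qed.

Lemma weight_gt0 m h : h \in histories m -> 0 < weight m h.
Proof.
elim: m h => [|m IH] h /=; first by rewrite inE => /eqP ->; rewrite weight0.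
move=> /allpairsPdep[g [j [gm]]]; rewrite mem_enum => jpi ->.
rewrite weight_rcons ?(size_history gm) // mulr_gt0 ?IH // /uniform_on jpi.
by rewrite invr_gt0 ltr0n; apply/card_gt0P; exists j.
Qed.

Lemma measure_partition_step m A : measurable A ->
  P A = (\sum_(j : V) P (A `&` [set w | X m w = j]))%E.
Proof.
move=> mA; rewrite fsbig_seq ?index_enum_uniq //.
rewrite (_ : [set` index_enum V] = [set: V]); last first.
  by apply/seteqP; split => // i _ /=; exact: mem_index_enum.
rewrite -measure_fin_bigcup //.
- rewrite -setI_bigcupr; congr (P _); apply/seteqP; split => w; last by case.
  by move=> Aw; split => //; exists (X m w).
- exact: finite_finset.
- by move=> i j _ _ [w /= [[_ <-] [_ <-]]].
- by move=> i _; exact: measurableI.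
Qed.

(** Up to a null set, the pasts of the histories partition the space: at time 0 by the starting
    condition, and then by splitting each past according to the next node. *)
Lemma total_probability m A : measurable A ->
  P A = (\sum_(h <- histories m) P (A `&` past X m (nth x0 h)))%E.
Proof.
move=> mA; elim: m => [|m IH] /=.
  rewrite big_seq1.
  have := weightE 0 [:: x0]; rewrite weight0 => P1.
  have P0 : P (~` past X 0 (nth x0 [:: x0])) = 0%E.
    by rewrite probability_setC ?P1 ?subee //; exact: measurable_past.
  rewrite -[in LHS](setIT A) -(setUv (past X 0 (nth x0 [:: x0]))) setIUr.
  have mp := measurable_past 0 (nth x0 [:: x0]).
  rewrite measureU //=; [|exact: measurableI|exact/measurableI/measurableC|].
    rewrite [X in (_ + X)%E](_ : _ = 0%E) ?adde0 //.
    apply: (subset_measure0 (measurableI _ _ mA (measurableC mp))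
      (measurableC mp)) => //.
  by rewrite setIACA setICr setI0.
rewrite IH big_allpairs_dep big_seq [RHS]big_seq.
apply: eq_bigr => h hm; have sh := size_history hm.
have mp := measurable_past m (nth x0 h).
rewrite (measure_partition_step m.+1) ?big_enum /=; last exact: measurableI.
rewrite (bigID (mem (pi m (nth x0 h)))) /= [X in (_ + X)%E]big1 ?adde0.
  by apply: eq_bigr => j _; rewrite past_rcons // setIA.
(* A node outside the candidates extends [h] with weight zero, so nothing is lost by leaving it
   out. *)
move=> j jpi.
have mp' := measurable_past m.+1 (nth x0 (rcons h j)).
rewrite -setIA -past_rcons //.
apply: (subset_measure0 (measurableI _ _ mA mp') mp') => //.
apply: (etrans (weightE _ _)).
by rewrite weight_rcons // /uniform_on (negbTE jpi) mulr0.
Qed.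

(** The event is determined by the nodes up to time [m], so it contains or misses each cell of the
    partition entirely. *)
Lemma probability_uncovered m :
  P [set w | uncovered (X^~ w) m] =
  (\sum_(h <- histories m | uncovered (nth x0 h) m) weight m h)%:E.
Proof.
rewrite (total_probability m); last exact: measurable_uncovered.
rewrite -sumEFin [RHS]big_mkcond; apply: eq_bigr => h _.
have unc w : past X m (nth x0 h) w ->
    uncovered (X^~ w) m = uncovered (nth x0 h) m.
  by move=> hw; apply: eq_uncovered => t tm; rewrite /= hw.
case: ifPn => hu.
  rewrite -weightE; congr (P _); apply/seteqP; split => [w []//|w hw].
  by split; rewrite //= unc.
rewrite [X in P X](_ : _ = set0) ?measure0 //.
by apply/seteqP; split => w //= [uw hw]; move: uw; rewrite unc // (negbTE hu).
Qed.

Lemma weight_sum m : \sum_(h <- histories m) weight m h = 1.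
Proof.
apply: EFin_inj; rewrite -sumEFin -(@probability_setT _ _ _ P).
rewrite (total_probability m measurableT).
by apply: eq_bigr => h _; rewrite setTI weightE.
Qed.

End Process.

(** * Closed forms for the two halves of the bound on the bias terms *)

Lemma sum_left_tent (b l k : nat) : (l < k)%N ->
  \sum_(0 <= j < k) (if (j <= l)%N then 2 * (b%:Z - j%:Z) else 0) =
  (l%:Z + 1) * (2 * b%:Z - l%:Z).
Proof.
move=> lk; rewrite (big_cat_nat (n := l.+1)) //= [X in _ + X]big_nat_cond.
rewrite [X in _ + X]big1 ?addr0; last by move=> j; case: ifP => //; lia.
rewrite (eq_big_nat _ _ (F2 := fun j => 2 * (b%:Z - j%:Z))); last first.
  by move=> j /andP[_]; rewrite ltnS => ->.
by elim: {lk} l => [|l IH]; rewrite ?big_nat1 ?[LHS]big_nat_recr //= ?IH; lia.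
Qed.

Lemma sum_right_tent (b r k : nat) : (r <= k)%N ->
  \sum_(0 <= j < k) (if (r <= j)%N then 2 * (j%:Z - b%:Z) else 0) =
  (k%:Z - r%:Z) * (k%:Z - 1 + r%:Z - 2 * b%:Z).
Proof.
elim: k => [|k IH]; first by rewrite leqn0 => /eqP ->; rewrite big_nil; lia.
rewrite leq_eqVlt => /predU1P[->|rk].
  by rewrite big_nat_cond big1 => [|j]; [lia|case: ifP => //; lia].
by rewrite big_nat_recr //= IH // -ltnS rk; lia.
Qed.

(** * The cycle cut open at a node *)

Section Cycle.
Variable n : nat.
Implicit Types (i j v : 'I_n.+1).

Lemma val_ordS i : ordS i = (if i == n :> nat then 0 else i.+1)%N :> nat.
Proof.
rewrite /=; have [->|ni] := eqVneq (i : nat) n; first by rewrite modnn.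
by rewrite modn_small // ltnS ltn_neqAle ni -ltnS ltn_ord.
Qed.

Lemma neighbours_cycle i :
  neighbours (@cycle_adj n) i = [set ord_pred i; ordS i]%SET.
Proof. by apply/setP => j; rewrite !inE /cycle_adj. Qed.

Section Position.
Variable v : 'I_n.+1.

(** Unrolls the cycle cut at [v]: the other nodes occupy the integers from v - n to v - 1, with node
    0 at the origin when it differs from [v]. The node [v] itself falls at v - n - 1, left of all
    others. *)
Definition position i : int := if (i < v)%N then i%:Z else i%:Z - n.+1%:Z.

Lemma position_inj : injective position.
Proof.
move=> i j ij; apply: val_inj => /=; move: ij; rewrite /position.
by have := ltn_ord i; have := ltn_ord j; case: ifP => ?; case: ifP; lia.
Qed.

Lemma position_ordS i : i != v -> ordS i != v ->
  position (ordS i) = position i + 1.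
Proof.
rewrite -!val_eqE /= -/(nat_of_ord (ordS i)) /position.
have -> : ((i.+1 %% n.+1)%N = ordS i :> nat) by [].
have := ltn_ord v; have := ltn_ord i; rewrite val_ordS.
case: (eqVneq (i : nat) n) => ?; case: ifP => ?; case: ifP; lia.
Qed.

Lemma position_ord_pred i : i != v -> ord_pred i != v ->
  position (ord_pred i) = position i - 1.
Proof.
move=> iv piv; have := @position_ordS (ord_pred i) piv.
by rewrite ord_predK => /(_ iv) ->; rewrite addrK.
Qed.

Lemma sum_position (F : int -> int) :
  \sum_(i | i != v) F (position i) =
  \sum_(0 <= k < n) F (k%:Z + v%:Z - n%:Z).
Proof.
rewrite (_ : \sum_(i | i != v) F (position i) =
  \sum_(0 <= i < n.+1 | i != v :> nat)
    F (if (i < v)%N then i%:Z else i%:Z - n.+1%:Z)); last by rewrite big_mkord.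
have vn : (v <= n)%N by rewrite -ltnS.
rewrite (big_cat_nat (n := v)) //=; last exact: leqW.
(* The nodes above [v] give the first n - v positions and those below [v] the last v, hence the swap
   of the two halves. *)
rewrite [in RHS](big_cat_nat (n := n - v)) ?leq_subr //= addrC; congr (_ + _).
  rewrite big_ltn_cond // eqxx /= -{1}(add0n v.+1) big_addn subSS.
  rewrite big_nat_cond [RHS]big_nat_cond; apply: eq_big => j.
    by rewrite andbT andbC; case: (j + v.+1 =P v)%N; lia.
  by move=> _; rewrite ifF; [congr F|]; lia.
rewrite -{1}(add0n (n - v)%N) big_addn subKn //.
rewrite big_nat_cond [RHS]big_nat_cond; apply: eq_big => j.
  by rewrite andbT; case: (j =P v :> nat); lia.
by move=> /andP[/andP[_ jv] _]; rewrite jv; congr F; lia.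
Qed.

End Position.

(** * Pathwise bound on the cover time under negative feedback *)

Section Bias.
Hypothesis n_ge2 : (2 <= n)%N.

(** The two neighbours differ by 2, which is nonzero modulo n + 1 because n is at least 2. *)
Lemma ord_pred_neq_ordS i : ord_pred i != ordS i.
Proof.
apply/eqP => /(congr1 (fun j => nat_of_ord (ordS j))); rewrite ord_predK.

rewrite !val_ordS; have := ltn_ord i; do !case: eqP; lia.
Qed.

Variable x : nat -> 'I_n.+1.

Lemma traversalsS t i j :
  traversals x t.+1 i j =
  (traversals x t i j + ((x t == i) && (x t.+1 == j)))%N.
Proof.
rewrite /traversals -!sum1dep_card [LHS]big_mkcond [in RHS]big_mkcond.
by rewrite big_ord_recr /=; case: ifP.
Qed.

Lemma traversals0 i j : traversals x 0 i j = 0%N.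
Proof. by apply: eq_card0 => -[]. Qed.

Definition bias t i : int :=
  (traversals x t i (ord_pred i))%:Z - (traversals x t i (ordS i))%:Z.

Lemma bias0 i : bias 0 i = 0.
Proof. by rewrite /bias !traversals0. Qed.

Lemma bias_ordS t i : x t.+1 = ordS (x t) ->
  bias t.+1 i = bias t i - (x t == i)%:Z.
Proof.
move=> xS; rewrite /bias !traversalsS xS.
have [->|//] := eqVneq (x t) i; last by rewrite /= !addn0 subr0.
by rewrite eqxx eq_sym (negbTE (ord_pred_neq_ordS i)) /=; lia.
Qed.

Lemma bias_ord_pred t i : x t.+1 = ord_pred (x t) ->
  bias t.+1 i = bias t i + (x t == i)%:Z.
Proof.
move=> xS; rewrite /bias !traversalsS xS.
have [->|//] := eqVneq (x t) i; last by rewrite /= !addn0 addr0.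
by rewrite eqxx (negbTE (ord_pred_neq_ordS i)) /=; lia.
Qed.

(** All that the pathwise bound uses of the policy: the move is never along the more used of the two
    edges. *)
Lemma Smin_cycle t : x t.+1 \in Smin (@cycle_adj n) x t (x t) ->
  x t.+1 = ordS (x t) /\ 0 <= bias t (x t) \/
  x t.+1 = ord_pred (x t) /\ bias t (x t) <= 0.
Proof.
rewrite inE neighbours_cycle => /andP[xn /forallP xmin].
have := xmin (ord_pred (x t)); have := xmin (ordS (x t)).
rewrite !inE !eqxx orbT /= /bias.
by move: xn; rewrite !inE => /orP[/eqP ->|/eqP ->]; [right|left];
  split => //; lia.
Qed.

Variables (m : nat) (v : 'I_n.+1).
Hypothesis x0 : x 0%N = ord0.
Hypothesis xmin : forall t, (t < m)%N ->
  x t.+1 \in Smin (@cycle_adj n) x t (x t).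
Hypothesis xv : forall t, (t <= m)%N -> x t != v.

Let p := position v.

Lemma sum_at (F : 'I_n.+1 -> int) j : \sum_i F i * (j == i)%:Z = F j.
Proof.
rewrite (bigD1 j) //= eqxx mulr1 big1 ?addr0 // => i ij.
by rewrite eq_sym (negbTE ij) mulr0.
Qed.

Record invariant t : Prop := Invariant {
  inv_bound : forall i, -1 <= bias t i <= 1;
  inv_v : bias t v = 0;
  inv_left : forall i, p i < p (x t) -> bias t i <= 0;
  inv_right : forall i, p (x t) < p i -> 0 <= bias t i;
  inv_linear : p (x t) + \sum_i bias t i = 0;
  inv_quadratic : p (x t) ^+ 2 + 2 * (\sum_i p i * bias t i) = t%:Z }.

(** A clockwise move from position p lowers the bias there by 1. This cancels the gain of 1 in the
    linear identity; in the quadratic one p^2 gains 2 p + 1 and the sum term loses 2 p, leaving 1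
    per step. Anticlockwise moves are symmetric. *)
Lemma invariant_all t : (t <= m)%N -> invariant t.
Proof.
elim: t => [_|t IH tm].
  have p0 : p (x 0) = 0.
    have := xv (leq0n m); rewrite x0 /p /position -val_eqE /=.
    by case: (v : nat).
  split; try by [rewrite bias0|move=> i; rewrite bias0].
    by rewrite p0 big1 // => i _; rewrite bias0.
  by rewrite p0 big1 // => i _; rewrite bias0 mulr0.
have [Ib Iv Il Ir I1 I2] := IH (ltnW tm).
have xtv := xv (ltnW tm); have xSv := xv tm.
have vF : (x t == v) = false by exact: negbTE.
have eqp i : p (x t) = p i -> x t = i by exact: position_inj.
case: (Smin_cycle (xmin tm)) => -[xS b0].
  have pS : p (x t.+1) = p (x t) + 1 by rewrite /p xS position_ordS // -xS.
  split.
  - move=> i; rewrite (bias_ordS _ xS); have := Ib i.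
    by have [<-|_] := eqVneq (x t) i; lia.
  - by rewrite (bias_ordS _ xS) Iv vF.
  (* The node just left now lies to the left of the walker; its bias was 0 or 1 and has dropped by
     1. *)
  - move=> i; rewrite pS (bias_ordS _ xS); have := Ib i; have := Il i.
    have [<-|ni] := eqVneq (x t) i; first by lia.
    have : p (x t) <> p i by move/eqp; apply/eqP.
    by lia.
  - move=> i; rewrite pS (bias_ordS _ xS); have := Ir i.
    by have [<-|ni] := eqVneq (x t) i; lia.
  - rewrite pS (eq_bigr (fun i => bias t i - 1 * (x t == i)%:Z)); last first.
      by move=> i _; rewrite (bias_ordS _ xS) mul1r.
    by rewrite sumrB (sum_at (fun=> 1)) addrACA subrr addr0.
  - rewrite pS (eq_bigr (fun i => p i * bias t i - p i * (x t == i)%:Z)); last first.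
      by move=> i _; rewrite (bias_ordS _ xS) mulrBr.
    by rewrite sumrB sum_at -[t.+1]addn1 PoszD -I2; ring.
have pS : p (x t.+1) = p (x t) - 1 by rewrite /p xS position_ord_pred // -xS.
split.
- move=> i; rewrite (bias_ord_pred _ xS); have := Ib i.
  by have [<-|_] := eqVneq (x t) i; lia.
- by rewrite (bias_ord_pred _ xS) Iv vF.
- move=> i; rewrite pS (bias_ord_pred _ xS); have := Il i.
  by have [<-|ni] := eqVneq (x t) i; lia.
- move=> i; rewrite pS (bias_ord_pred _ xS); have := Ib i; have := Ir i.
  have [<-|ni] := eqVneq (x t) i; first by lia.
  have : p (x t) <> p i by move/eqp; apply/eqP.
  by lia.
- rewrite pS (eq_bigr (fun i => bias t i + 1 * (x t == i)%:Z)); last first.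
    by move=> i _; rewrite (bias_ord_pred _ xS) mul1r.
  by rewrite big_split /= (sum_at (fun=> 1)) addrACA addNr addr0.
- rewrite pS (eq_bigr (fun i => p i * bias t i + p i * (x t == i)%:Z)); last first.
    by move=> i _; rewrite (bias_ord_pred _ xS) mulrDr.
  by rewrite big_split /= sum_at -[t.+1]addn1 PoszD -I2; ring.
Qed.

Lemma uncovered_time_bound : (2 * m < n * n.+1)%N.
Proof.
have [Ib Iv Il Ir I1 I2] := invariant_all (leqnn m).
have v_gt0 : (0 < v)%N.
  by have := xv (leq0n m); rewrite x0 -val_eqE /=; case: (v : nat).
have vn : (v <= n)%N by rewrite -ltnS.
have [jx jxE jxn] : exists2 jx : nat, p (x m) = jx%:Z + v%:Z - n%:Z & (jx < n)%N.
  have := xv (leqnn m); rewrite /p /position -val_eqE /=.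
  have := ltn_ord (x m); case: ifP => c.
    by exists (x m + n - v)%N; lia.
  by exists (x m - v.+1)%N; lia.
(* Positions are relabelled 0, ..., n - 1 from the left, [jx] being the walker. The constant [c] is
   the sum of the two end positions, and [b] is the label at which the weight p i - c vanishes. *)
pose b := v.-1; pose l := minn b jx; pose r := maxn b jx.
pose c : int := 2 * v%:Z - n%:Z - 1.
pose H (j : nat) : int := (if (j <= l)%N then 2 * (b%:Z - j%:Z) else 0) +
                          (if (r <= j)%N then 2 * (j%:Z - b%:Z) else 0).
have mE : m%:Z = p (x m) ^+ 2 - 2 * c * p (x m) +
    \sum_(i | i != v) 2 * (p i - c) * bias m i.
  rewrite -I2; have -> : \sum_(i | i != v) 2 * (p i - c) * bias m i =
      \sum_i (2 * (p i * bias m i) - 2 * c * bias m i).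
    by rewrite [RHS](bigD1 v) //= Iv !mulr0 subrr add0r; apply: eq_bigr => i _; ring.
  rewrite sumrB -!mulr_sumr; have -> : \sum_i bias m i = - p (x m) by lia.
  by ring.
(* The bias is at most 0 left of the walker and at least 0 right of it, so a term can be positive
   only outside the gap between [b] and [jx]; there it is at most twice the distance to [b]. *)
have bnd : \sum_(i | i != v) 2 * (p i - c) * bias m i <=
    \sum_(i | i != v) H (absz (p i - v%:Z + n%:Z)).
  apply: ler_sum => i iv.
  have [j jE jn] : exists2 j : nat, p i = j%:Z + v%:Z - n%:Z & (j < n)%N.
    move: iv; rewrite /p /position -val_eqE /=.
    have := ltn_ord i; case: ifP => ci.
      by exists (i + n - v)%N; lia.
    by exists (i - v.+1)%N; lia.
  have -> : absz (p i - v%:Z + n%:Z) = j by lia.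
  have pc : p i - c = j%:Z - b%:Z by rewrite jE /c /b; lia.
  rewrite pc /H; have := Ib i; have := Il i; have := Ir i.
  rewrite jE jxE; set y := bias m i => y1 y2 y3.
  have [jl|jl] := leqP j l; have [rj|rj] := leqP r j; rewrite /l /r in jl rj.
  - have -> : j = b by lia.
    by rewrite subrr mulr0 mul0r.
  - nia.
  - nia.
  - nia.
move: bnd; rewrite (sum_position _ (fun z => H (absz (z - v%:Z + n%:Z)))).
rewrite (eq_bigr H); last by move=> j _; congr H; lia.
rewrite big_split /= sum_left_tent ?sum_right_tent; [|lia|lia].
rewrite /l /r; move: mE; set S := \sum_(i | i != v) _ => mE bnd.
have vE : v%:Z = b%:Z + 1 by rewrite /b; lia.
pose a : int := n%:Z - 1 - b%:Z; have nE : n%:Z = a + b%:Z + 1 by rewrite /a; lia.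
(* The product z (z - 1) is nonnegative for integers; with z = a - b or b - a it is part of the
   slack between n (n + 1) and the bound on 2 m. *)
have sq (z : int) : 0 <= z * (z - 1) by nia.
have sq1 := sq (a - b%:Z); have sq2 := sq (b%:Z - a).
(* Completes the square in p^2 - 2 c p, with c = b - a. *)
have mE' : m%:Z = (jx%:Z - b%:Z) ^+ 2 - (b%:Z - a) ^+ 2 + S.
  by rewrite mE jxE /c vE nE; ring.
suff : 2 * m%:Z < n%:Z * (n%:Z + 1) by lia.
have [bj|jb] := leqP b jx.
  rewrite (minn_idPl bj) (maxn_idPr bj) in bnd.
  have y_le : jx%:Z - b%:Z <= a by lia.
  have m_le : m%:Z <= 2 * (a * b%:Z) + a + b%:Z + (jx%:Z - b%:Z).
    rewrite mE' -lerBrDl (le_trans bnd) // nE le_eqVlt; apply/orP; left.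
    by apply/eqP; ring.
  have -> : n%:Z * (n%:Z + 1) =
      2 * (2 * (a * b%:Z) + 2 * a + b%:Z) + (a - b%:Z) * (a - b%:Z - 1) + 2.
    by rewrite nE; ring.
  by move: sq1 m_le; move: (_ * (_ - 1)) (a * b%:Z) => s1 s2; lia.
rewrite (minn_idPr (ltnW jb)) (maxn_idPl (ltnW jb)) in bnd.
have m_le : m%:Z <= 2 * (a * b%:Z) + a + b%:Z + (b%:Z - jx%:Z).
  rewrite mE' -lerBrDl (le_trans bnd) // nE le_eqVlt; apply/orP; left.
  by apply/eqP; ring.
have -> : n%:Z * (n%:Z + 1) =
    2 * (2 * (a * b%:Z) + 2 * b%:Z + a) + (b%:Z - a) * (b%:Z - a - 1) + 2.
  by rewrite nE; ring.
by move: sq2 m_le; move: (_ * (_ - 1)) (a * b%:Z) => s1 s2; lia.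
Qed.
End Bias.
End Cycle.

(** * The visited arc of a nearest-neighbour path and its potential *)

Definition in_orbit (T : Type) (f : T -> T) (y : T) (k : nat) (i : T) : Prop :=
  exists2 j : nat, (j < k)%N & i = iter j f y.

(** After a step along [f] the arc behind gains a node and the one ahead loses one, but never the
    current node, hence the [maxn]. Keeping [f] and [g] abstract serves both directions of the
    cycle. *)
Lemma in_orbit_step (T : Type) (f g : T -> T) (y i : T) (u w : nat) :
  cancel f g -> (0 < u)%N ->
  in_orbit g (f y) u.+1 i \/ in_orbit f (f y) (maxn w.-1 1) i <->
  i = f y \/ in_orbit g y u i \/ in_orbit f y w i.
Proof.
move=> fK u0; split.
  move=> [[[|j] ju ->]|[j jw ->]]; first by left.
    by right; left; exists j; rewrite // iterSr fK.
  case: j jw => [|j] jw; first by left.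
  by right; right; exists j.+2; [lia|rewrite -iterSr].
move=> [->|[[j ju ->]|[j jw ->]]]; first by left; exists 0%N.
  by left; exists j.+1; rewrite // iterSr fK.
case: j jw => [|j] jw; first by left; exists 1%N; rewrite //= fK.
by right; exists j; [lia|rewrite -iterSr].
Qed.

Section Arc.
Variable n : nat.
Implicit Types (x : nat -> 'I_n.+1).

(* The visited set is the arc of the nodes at distance less than [u]
   anticlockwise and less than [w] clockwise from the current node. *)
Fixpoint arc x (m : nat) : nat * nat :=
  if m is m'.+1 then
    let: (u, w) := arc x m' in
    if x m == ordS (x m') then (u.+1, maxn w.-1 1) else (maxn u.-1 1, w.+1)
  else (1, 1)%N.

Lemma arc_gt0 x m : (0 < (arc x m).1)%N && (0 < (arc x m).2)%N.
Proof.
by elim: m => //= m; case: (arc x m) => u w /=; case: ifP => _ /=; lia.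
Qed.

Lemma eq_arc x y m : (forall t, (t <= m)%N -> x t = y t) -> arc x m = arc y m.
Proof.
elim: m => //= m IH xy; rewrite IH ?xy // => t tm.
by apply: xy; exact: leqW.
Qed.

(** Each step adds the new node to the visited set. The equivalence persists after covering, when
    the two orbits overlap. *)
Lemma arc_visited x m :
  (forall t, (t < m)%N -> x t.+1 \in neighbours (@cycle_adj n) (x t)) ->
  forall i, (exists2 t, (t <= m)%N & x t = i) <->
    in_orbit (@ord_pred n.+1) (x m) (arc x m).1 i \/
    in_orbit (@ordS n.+1) (x m) (arc x m).2 i.
Proof.
elim: m => [|m IH] step i.
  split; first by move=> [t]; rewrite leqn0 => /eqP -> <-; left; exists 0%N.
  by move=> [] [[|//] _ ->]; exists 0%N.
have {}IH := IH (fun t tm => step t (leqW tm)) i.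
have visS : (exists2 t, (t <= m.+1)%N & x t = i) <->
    i = x m.+1 \/ exists2 t, (t <= m)%N & x t = i.
  split=> [[t]|[->|[t tm <-]]]; last 2 first.
  - by exists m.+1.
  - by exists t; rewrite // leqW.
  by rewrite leq_eqVlt => /predU1P[-> <-|tm <-]; [left|right; exists t].
have := arc_gt0 x m; have := step m (leqnn _); rewrite neighbours_cycle !inE /=.
move: IH; case: (arc x m) => u w /= IH xm1 /andP[u0 w0].
apply: (iff_trans visS); have [xS|xnS] := eqVneq (x m.+1) (ordS (x m)) => /=.
  apply: (iff_trans _ (iff_sym _)); last first.
    by rewrite xS; apply: in_orbit_step u0; exact: ordSK.
  by rewrite -xS; split=> -[->|/IH]; tauto.
have xP : x m.+1 = ord_pred (x m).
  by move: xm1; rewrite (negbTE xnS) orbF => /eqP.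
have := in_orbit_step (x m) i u (@ord_predK n.+1) w0; rewrite -xP; tauto.
Qed.

Lemma iter_ordS (i : 'I_n.+1) k :
  iter k (@ordS n.+1) i = ((i + k) %% n.+1)%N :> nat.
Proof.
elim: k => [|k IH]; first by rewrite addn0 modn_small.
by rewrite iterS /= IH -addn1 modnDml addn1 addnS.
Qed.

Lemma iter_ord_pred (i : 'I_n.+1) k : (k <= n.+1)%N ->
  iter k (@ord_pred n.+1) i = iter (n.+1 - k) (@ordS n.+1) i.
Proof.
move=> kn; have fullturn : iter n.+1 (@ordS n.+1) i = i.
  by apply: ord_inj; rewrite iter_ordS modnDr modn_small.
have itK (j : 'I_n.+1) : iter k (@ord_pred n.+1) (iter k (@ordS n.+1) j) = j.
  by elim: k {kn} j => // k IH j; rewrite iterSr iterS ordSK IH.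
rewrite -[in LHS]fullturn.
have := iterD k (n.+1 - k) (@ordS n.+1) i.
by rewrite subnKC // => ->; rewrite itK.
Qed.

Lemma arc_full (y : 'I_n.+1) u w : (0 < u)%N -> (0 < w)%N ->
  (forall i, in_orbit (@ord_pred n.+1) y u i \/ in_orbit (@ordS n.+1) y w i) <->
  (n.+2 <= u + w)%N.
Proof.
move=> u0 w0; split=> [all_i|uw i].
  (* The two orbits share the current node; starting the second list at 1 leaves u + w - 1
     entries. *)
  pose s := [seq iter k (@ord_pred n.+1) y | k <- iota 0 u] ++
            [seq iter k (@ordS n.+1) y | k <- iota 1 w.-1].
  have : (#|'I_n.+1| <= size s)%N.
    rewrite cardE; apply: uniq_leq_size => [|i _]; first exact: enum_uniq.
    rewrite mem_cat; apply/orP; case: (all_i i) => [[k ku ->]|[[|k] kw ->]].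
    - by left; apply: map_f; rewrite mem_iota.
    - by left; apply/mapP; exists 0%N; rewrite // mem_iota.
    - by right; apply/mapP; exists k.+1; rewrite // mem_iota; lia.
  by rewrite card_ord size_cat !size_map !size_iota; lia.
(* The clockwise distance from [y] to [i]; the anticlockwise one is n + 1 - k. *)
pose k := ((i + (n.+1 - y)) %% n.+1)%N.
have kn : (k <= n)%N by rewrite -ltnS ltn_mod.
have ik : i = iter k (@ordS n.+1) y.
  apply: ord_inj; rewrite iter_ordS /k modnDmr addnCA subnKC ?(ltnW (ltn_ord y)) //.
  by rewrite modnDr modn_small.
have [kw|wk] := ltnP k w; first by right; exists k.
left; exists (n.+1 - k)%N; first by lia.
by rewrite iter_ord_pred ?leq_subr // subKn // leqW.
Qed.

Lemma uncovered_arc x m :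
  (forall t, (t < m)%N -> x t.+1 \in neighbours (@cycle_adj n) (x t)) ->
  uncovered x m = ((arc x m).1 + (arc x m).2 < n.+2)%N.
Proof.
move=> step; have /andP[u0 w0] := arc_gt0 x m.
have vis := arc_visited step; have full := arc_full (x m) u0 w0.
rewrite ltnNge; apply: negb_inj; rewrite negbK; apply/coveredP/idP => [h|h i].
  by apply/full => i; apply/vis; exact: h.
by apply/vis; move: i; apply/full.
Qed.

(* u * w is the expected time to leave the arc (gambler's ruin), and l the one
   to leave an arc of l nodes just after its last node has been reached. *)
Definition potential (s : nat * nat) : nat :=
  if (n.+2 <= s.1 + s.2)%N then 0
  else (s.1 * s.2 + \sum_(s.1 + s.2 <= l < n.+1) l)%N.

Lemma potential_start : (0 < n)%N -> potential (1, 1)%N = 'C(n.+1, 2).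
Proof.
move=> n_gt0; rewrite /potential /= ifF; last by lia.
rewrite -bin2_sum (big_ltn (m := 0)) // (big_ltn (m := 1)); last by lia.
by rewrite add0n muln1 addn1.
Qed.

(** At an end of the arc the product equals w + 1 and becomes the first term of the sum; for w = n
    the graph is covered and the sum is empty. *)
Lemma potential_boundary w : (w <= n)%N ->
  potential (1, w.+1)%N = (\sum_(w.+1 <= l < n.+1) l)%N.
Proof.
move=> wn; rewrite /potential /= !add1n; case: ifP => h.
  by rewrite big_geq //; lia.
by rewrite mul1n [RHS]big_ltn //; lia.
Qed.

Lemma potentialC u w : potential (u, w) = potential (w, u).
Proof. by rewrite /potential /= addnC mulnC. Qed.

Lemma potential_left u w : (0 < u)%N -> (u + w < n.+2)%N ->
  potential (maxn u.-1 1, w.+1)%N =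
  (u.-1 * w.+1 + \sum_(u + w <= l < n.+1) l)%N.
Proof.
case: u => [//|[|u]] _ uw.
  by rewrite potential_boundary //; lia.
rewrite (_ : maxn _ _ = u.+1); last by lia.
by rewrite /potential /= -addSnnS ifF //; lia.
Qed.

(** While uncovered, (u - 1) (w + 1) + (u + 1) (w - 1) = 2 u w - 2 and the sum is common to both
    moves, even when one reaches a new node. Afterwards all potentials vanish. *)
Lemma potential_step u w : (0 < u)%N -> (0 < w)%N ->
  (potential (maxn u.-1 1, w.+1) + potential (u.+1, maxn w.-1 1) +
   2 * (u + w < n.+2) = 2 * potential (u, w))%N.
Proof.
move=> u0 w0; case: ltnP => uw.
  rewrite [X in (_ + X + _)%N]potentialC !potential_left // 1?[(w + u)%N]addnC //.
  rewrite [in RHS]/potential /= ifF; last by lia.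
  move: (\sum_(_ <= l < _) l)%N => S.
  by case: u w u0 w0 {uw} => [//|u] [//|w] _ _ /=; lia.
by rewrite /potential /= !ifT //; lia.
Qed.

(** Crude, but enough to bound the mean potential by a multiple of the probability of being
    uncovered. *)
Lemma potential_le s :
  (potential s <= (n.+2 ^ 2 + 'C(n.+1, 2)) * (s.1 + s.2 < n.+2))%N.
Proof.
case: s => u w; rewrite /potential /=; case: (leqP n.+2 (u + w)) => uw //.
rewrite muln1 leq_add //.
  by rewrite -mulnn leq_mul; lia.
by rewrite -bin2_sum [leqRHS](big_cat_nat (n := u + w)) ?leq_addl //; lia.
Qed.

End Arc.

(** * Both policies depend on the past only *)

Lemma adapted_rw (V : finType) (e : rel V) : adapted (pi_rw e).
Proof. by move=> m x y xy; rewrite /pi_rw xy. Qed.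

Lemma adapted_neg (V : finType) (e : rel V) : adapted (pi_neg e).
Proof.
move=> m x y xy; have trE i j : traversals x m i j = traversals y m i j.
  apply: eq_card => t; rewrite !inE !xy //; exact: ltnW.
rewrite /pi_neg /Smin xy //; apply/setP => j; rewrite !inE; congr (_ && _).
by apply: eq_forallb => k; rewrite !trE.
Qed.

Lemma triangular_real (R : realType) n :
  2^-1 * (n.+1%:R * n%:R) = 'C(n.+1, 2)%:R :> R.
Proof.
have := mul_bin_diag n.+1 1; rewrite bin1 -natrM => ->.
by rewrite natrM mulrA mulVf ?mul1r // pnatr_eq0.
Qed.

(** * Expected cover time of the random walk *)

Section RandomWalk.
Context d (T : measurableType d) (R : realType) (P : probability T R).
Variables (n : nat) (n_ge2 : (2 <= n)%N) (X : nat -> T -> 'I_n.+1).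
Let pi := pi_rw (@cycle_adj n).
Hypothesis followsX : follows P ord0 pi X.

Local Notation path h := (nth ord0 h).
Local Notation weight := (weight P ord0 X).

Let uncovered_mass m : R :=
  \sum_(h <- histories ord0 pi m | uncovered (path h) m) weight m h.

Let mean_potential m : R :=
  \sum_(h <- histories ord0 pi m)
    weight m h * (potential n (arc (path h) m))%:R.

Lemma uncovered_history m h : h \in histories ord0 pi m ->
  uncovered (path h) m =
  ((arc (path h) m).1 + (arc (path h) m).2 < n.+2)%N.
Proof.
move=> hm; apply: uncovered_arc => // t tm.
exact: (history_step (@adapted_rw _ _) hm).
Qed.

(** Each history has two continuations of half its weight, so [potential_step] gives a drop by its
    weight if it is uncovered and by 0 otherwise. *)
Lemma mean_potentialS m :
  mean_potential m.+1 = mean_potential m - uncovered_mass m.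
Proof.
rewrite /mean_potential /uncovered_mass /= big_allpairs_dep.
rewrite [X in _ = _ - X]big_mkcond -sumrB big_seq [RHS]big_seq.
apply: eq_bigr => h hm; have sh := size_history hm.
rewrite big_enum /= /pi /pi_rw neighbours_cycle big_setU1 ?big_set1 /=; last first.
  by rewrite inE ord_pred_neq_ordS.
have arc_h j : arc (path (rcons h j)) m = arc (path h) m.
  by apply: eq_arc => t tm; exact: nth_rcons_le sh tm.
rewrite !(nth_rcons_last _ _ sh) !(nth_rcons_le _ _ sh (leqnn m)) !arc_h eqxx.
rewrite (negbTE (ord_pred_neq_ordS n_ge2 _)) !(weight_rcons followsX) //.
rewrite /uniform_on /pi /pi_rw neighbours_cycle !inE !eqxx orbT /=.
rewrite cards2 ord_pred_neq_ordS //= (uncovered_history hm).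
have /andP[] := arc_gt0 (path h) m; case: (arc (path h) m) => u w /= u0 w0.
have : (potential n (maxn u.-1 1, w.+1))%:R +
    (potential n (u.+1, maxn w.-1 1))%:R + 2 * (u + w < n.+2)%:R =
    2 * (potential n (u, w))%:R :> R.
  by rewrite -!natrM -!natrD potential_step.
case: ifP => _ /= E.
  have -> : (potential n (u, w))%:R = ((potential n (maxn u.-1 1, w.+1))%:R +
      (potential n (u.+1, maxn w.-1 1))%:R + 2) / 2 :> R by lra.
  by field.
have -> : (potential n (u, w))%:R = ((potential n (maxn u.-1 1, w.+1))%:R +
      (potential n (u.+1, maxn w.-1 1))%:R) / 2 :> R by lra.
by field.
Qed.

Lemma uncovered_mass_sum m :
  \sum_(0 <= k < m) uncovered_mass k = 'C(n.+1, 2)%:R - mean_potential m.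
Proof.
elim: m => [|m IH].
  rewrite big_nil /mean_potential /= big_seq1 (weight0 followsX) mul1r.
  by rewrite potential_start ?(ltnW n_ge2) // subrr.
by rewrite big_nat_recr //= IH mean_potentialS; ring.
Qed.

Lemma uncovered_mass_ge0 m : 0 <= uncovered_mass m.
Proof. by apply: sumr_ge0 => h _; exact: weight_ge0. Qed.

Lemma mean_potential_ge0 m : 0 <= mean_potential m.
Proof. by apply: sumr_ge0 => h _; rewrite mulr_ge0 ?weight_ge0. Qed.

Lemma mean_potential_le m :
  mean_potential m <= (n.+2 ^ 2 + 'C(n.+1, 2))%:R * uncovered_mass m.
Proof.
rewrite /mean_potential /uncovered_mass mulr_sumr [leRHS]big_mkcond /=.
rewrite big_seq [leRHS]big_seq; apply: ler_sum => h hm.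
rewrite (uncovered_history hm) mulrC.
have := potential_le n (arc (path h) m); case: ifP => _.
  by rewrite muln1 => le_C; rewrite ler_wpM2r ?weight_ge0 // ler_nat.
by rewrite muln0 leqn0 => /eqP ->; rewrite mul0r.
Qed.

(** The telescoped identity bounds the partial sums of [uncovered_mass], so its terms tend to 0, and
    they dominate the mean potential up to a constant. *)
Lemma mean_potential_cvg0 : mean_potential @ \oo --> (0 : R).
Proof.
have mass_cvg : uncovered_mass @ \oo --> (0 : R).
  apply: cvg_series_cvg_0; apply: nondecreasing_is_cvgn.
    apply/nondecreasing_seqP => m; rewrite /series /= big_nat_recr //=.
    by rewrite lerDl uncovered_mass_ge0.
  exists 'C(n.+1, 2)%:R => _ [m _ <-].
  by rewrite /series /= uncovered_mass_sum gerBl mean_potential_ge0.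
apply: (squeeze_cvgr (f := fun=> 0)
  (h := fun m => (n.+2 ^ 2 + 'C(n.+1, 2))%:R * uncovered_mass m)).
- by apply: nearW => m; rewrite mean_potential_ge0 mean_potential_le.
- exact: cvg_cst.
- by rewrite -[X in _ --> X](mulr0 (n.+2 ^ 2 + 'C(n.+1, 2))%:R); exact: cvgMr.
Qed.

Lemma expected_cover_time_rw :
  expected_cover_time P X = ('C(n.+1, 2)%:R)%:E.
Proof.
rewrite (expected_cover_time_tail followsX).
apply: cvg_lim => //.
rewrite (_ : (fun m => _) = EFin \o (fun m => 'C(n.+1, 2)%:R - mean_potential m)).
  apply: cvg_EFin; first by exact: nearW.
  rewrite -[X in _ --> X]subr0.
  by apply: cvgB; [exact: cvg_cst|exact: mean_potential_cvg0].
apply/funext => m /=; rewrite -uncovered_mass_sum -sumEFin.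
by apply: eq_bigr => k _; exact: (probability_uncovered followsX).
Qed.

End RandomWalk.

(** * Strict bound on the expected cover time under negative feedback *)

Section NegativeFeedback.
Context d (T : measurableType d) (R : realType) (P : probability T R).
Variables (n : nat) (n_ge2 : (2 <= n)%N) (X : nat -> T -> 'I_n.+1).
Let pi := pi_neg (@cycle_adj n).
Hypothesis followsX : follows P ord0 pi X.

Lemma history_start m h : h \in histories ord0 pi m -> nth ord0 h 0 = ord0.
Proof.
elim: m h => [|m IH] h /=; first by rewrite inE => /eqP ->.
move=> /allpairsPdep[g [j [gm _ ->]]].
by rewrite (nth_rcons_le _ _ (size_history gm)) // IH.
Qed.

Lemma covered_history m h : ('C(n.+1, 2) <= m)%N ->
  h \in histories ord0 pi m -> ~~ uncovered (nth ord0 h) m.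
Proof.
move=> mM hm; apply/negP; rewrite /uncovered negb_forall => /existsP[v].
move=> /existsPn hv.
have := uncovered_time_bound n_ge2 (history_start hm)
  (history_step (@adapted_neg _ _) hm) (v := v).
have /[swap]/[apply] : forall t, (t <= m)%N -> nth ord0 h t != v.
  by move=> t tm; exact: hv (Ordinal (tm : (t < m.+1)%N)).
by have := mul_bin_diag n.+1 1; rewrite bin1; nia.
Qed.

Definition sweep m : seq 'I_n.+1 := mkseq inord m.+1.

Lemma sweep_history m : (m <= n)%N -> sweep m \in histories ord0 pi m.
Proof.
elim: m => [_|m IH mn] /=.
  rewrite inE /sweep /mkseq /=; apply/eqP; congr [:: _].
  by apply: val_inj; rewrite /= inordK.
apply/allpairsPdep; exists (sweep m), (inord m.+1).
split; [exact/IH/ltnW| |by rewrite /sweep mkseqS].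
rewrite mem_enum /pi /pi_neg.
have nth_sweep t : (t <= m)%N -> nth ord0 (sweep m) t = inord t.
  by move=> tm; rewrite nth_mkseq.
(* The sweep has not left its last node yet, so all counts there are 0 and every neighbour is a
   minimizer. *)
have fresh j : traversals (nth ord0 (sweep m)) m (inord m) j = 0%N.
  apply: eq_card0 => t; rewrite !inE nth_sweep ?(ltnW (ltn_ord t)) //.
  apply/negP => /andP[/eqP/(congr1 val) /= + _].
  by rewrite !inordK; have := ltn_ord t; lia.
rewrite nth_sweep // inE neighbours_cycle !inE; apply/andP; split.
  apply/orP; right; apply/eqP/ord_inj.
  by rewrite val_ordS !inordK ?ifF //; lia.
by apply/forallP => k; rewrite !fresh implybT.
Qed.

Lemma sweep_covers : ~~ uncovered (nth ord0 (sweep n)) n.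
Proof.
apply/coveredP => i; exists (val i); first by rewrite -ltnS /=.
by rewrite nth_mkseq ?ltn_ord // inord_val.
Qed.

Lemma probability_uncovered_sweep :
  (P [set w | uncovered (X^~ w) n] < 1)%E.
Proof.
rewrite (probability_uncovered followsX) lte_fin -(weight_sum followsX n).
rewrite [ltRHS](bigID (fun h => uncovered (nth ord0 h) n)) /= ltrDl.
have sweep_n := sweep_history (leqnn n).
rewrite (big_rem _ sweep_n) /= sweep_covers ltr_wpDr ?(weight_gt0 followsX) //.
by apply: sumr_ge0 => h _; exact: weight_ge0.
Qed.

(** By the pathwise bound only the first ['C(n.+1, 2)] tail probabilities can be nonzero. Each is at
    most 1, and the one at time n is smaller because of the sweep. *)
Lemma expected_cover_time_neg :
  (expected_cover_time P X < ('C(n.+1, 2)%:R)%:E)%E.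
Proof.
rewrite (expected_cover_time_tail followsX) (nneseries_split 0 'C(n.+1, 2)) //.
rewrite add0n eseries0 ?adde0; last first.
  move=> m mM _; rewrite (probability_uncovered followsX) big_seq_cond big1 //.
  by move=> h /andP[hm]; rewrite (negbTE (covered_history mM hm)).
(* Time n is among the remaining terms since n is at least 2. *)
have nM : (n < 'C(n.+1, 2))%N.
  by have := mul_bin_diag n.+1 1; rewrite bin1; nia.
rewrite big_mkord; under eq_bigr do rewrite (probability_uncovered followsX).
rewrite sumEFin.
rewrite lte_fin -[X in _ < X%:R]card_ord -sumr_const.
rewrite (bigD1 (Ordinal nM)) //= [ltRHS](bigD1 (Ordinal nM)) //=.
apply: ltr_leD.
  have := probability_uncovered_sweep.
  by rewrite (probability_uncovered followsX) lte_fin.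
apply: ler_sum => m _; rewrite -lee_fin -(probability_uncovered followsX).
exact: probability_le1 (measurable_uncovered followsX _).
Qed.

End NegativeFeedback.

Theorem theorem5 (R : realType) (n : nat) (hn : (2 <= n)%N)
  (d1 : measure_display) (T1 : measurableType d1) (P1 : probability T1 R)
  (Xneg : nat -> T1 -> 'I_n.+1)
  (hneg : follows P1 ord0 (pi_neg (@cycle_adj n)) Xneg)
  (d2 : measure_display) (T2 : measurableType d2) (P2 : probability T2 R)
  (Xrw : nat -> T2 -> 'I_n.+1)
  (hrw : follows P2 ord0 (pi_rw (@cycle_adj n)) Xrw) :
  (expected_cover_time P1 Xneg < (2^-1 * (n.+1%:R * n%:R))%:E)%E /\
  (2^-1 * (n.+1%:R * n%:R))%:E = expected_cover_time P2 Xrw.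
Proof.
rewrite triangular_real (expected_cover_time_rw hn hrw); split=> //.
exact: expected_cover_time_neg.
Qed.
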